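(* Let $\nu$ be an $\epsilon$-approximate unitary $k$-design on $\mathcal{U}(d)$ that is discrete, i.e. contains a finite number $S$ of unitaries. Let $f(U)$ be any (complex-valued) function of the matrix elements of $U$ and let $\mu$ be any constant. Then either $f(U)=\mu$ for all $U$ in $\nu$, or for some $\delta>0$ $$\mathbb{P}_\nu(|f-\mu|\ge\delta)\ge p_{\min},$$ where $p_{\min}$ is the probability of choosing the least probable unitary from $\nu$. If the probability is uniform, $p_{\min}=1/S$.
   Context: $\mathcal{U}(d)$ is the group of $d\times d$ unitary matrices. ''$U$ in $\nu$'' means that $U$ is one of the $S$ unitaries to which $\nu$ assigns positive probability, and $p_{\min}$ is the minimum of these $S$ positive probabilities. $\mathbb{P}_\nu,\mathbb{E}_\nu$ are probability and expectation for $U$ drawn from $\nu$; $\mathbb{E}_H$ is expectation with respect to Haar measure. A balanced monomial of degree $j$ in the elements of $U$ is a product of $j$ matrix elements of $U$ and $j$ complex conjugates of matrix elements of $U$. A probability distribution $\nu$ on $\mathcal{U}(d)$ is an $\epsilon$-approximate unitary $k$-design if for all balanced monomials $M$ of degree $\le k$, $|\mathbb{E}_\nu M(U)-\mathbb{E}_H M(U)|\le\epsilon/d^k$. *)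

(* Defs.v *)
From HB Require Import structures.
From mathcomp Require Import all_boot all_order all_algebra finmap.
From mathcomp Require Import all_classical all_reals all_analysis.
From mathcomp Require Import complex.

Set Implicit Arguments.
Unset Strict Implicit.
Unset Printing Implicit Defensive.

Import Order.TTheory GRing.Theory Num.Theory.
Import numFieldNormedType.Exports.

Local Open Scope classical_set_scope.
Local Open Scope complex_scope.
Local Open Scope ring_scope.

(* The usual topology of the complex numbers, i.e. the one induced by the
   modulus, which the library provides only for abstract number fields. *)
#[non_forgetful_inheritance]
HB.instance Definition _ (R : realType) :=
  PseudoPointedMetric.copy R[i] (R[i])^o.

Section UnitaryGroup.
Variables (R : realType) (d : nat).

(* U(d), with the topology induced by that of the d x d complex matrices. *)
Definition unitary := set_type [set U : 'M[R[i]]_d | U \is unitarymx].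

HB.instance Definition _ := Topological.on unitary.

Definition umx (U : unitary) : 'M[R[i]]_d := set_val U.

Lemma umx_unitary (U : unitary) : umx U \is unitarymx.
Proof. exact: (set_valP U). Qed.

Definition umul (U V : unitary) : unitary :=
  exist _ (umx U *m umx V)
    (mem_set (mul_unitarymx (umx_unitary U) (umx_unitary V))).

Lemma umx1_unitary : (1%:M : 'M[R[i]]_d) \is unitarymx.
Proof. by apply/unitarymxP; rewrite trmx1 map_mx1 mulmx1. Qed.

HB.instance Definition _ :=
  isPointed.Build unitary (exist _ 1%:M (mem_set umx1_unitary)).

(* The Borel sigma-algebra of U(d). *)
HB.instance Definition _ :=
  @isMeasurable.Build (sigma_display (@open unitary)) unitary
    <<s @open unitary >> (@sigma_algebra0 _ setT _)
    (@sigma_algebraC unitary (@open unitary))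
    (@sigma_algebra_bigcup _ setT _).

End UnitaryGroup.

Section Designs.
Variables (R : realType) (d : nat).

(* U(d) is compact, so there is exactly one left-invariant Borel probability
   measure, and it is right-invariant as well. *)
Definition is_haar (H : probability (unitary R d) R) :=
  forall (V : unitary R d) (A : set (unitary R d)),
    measurable A -> H (umul V @` A) = H A.

Definition cexpectation (P : probability (unitary R d) R)
    (F : 'M[R[i]]_d -> R[i]) : R[i] :=
  fine 'E_P[fun U => complex.Re (F (umx U))]%E +i* fine 'E_P[fun U => complex.Im (F (umx U))]%E.

Definition balanced_monomial (j : nat) (M : 'M[R[i]]_d -> R[i]) :=
  exists a b : 'I_j -> 'I_d * 'I_d,
    M = fun U => (\prod_(t < j) U (a t).1 (a t).2) *
                 (\prod_(t < j) (U (b t).1 (b t).2)^*).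

Definition approx_design (H nu : probability (unitary R d) R)
    (eps : R) (k : nat) :=
  forall (j : nat) (M : 'M[R[i]]_d -> R[i]),
    (j <= k)%N -> balanced_monomial j M ->
    `|cexpectation nu M - cexpectation H M| <= (eps / d%:R ^+ k)%:C.

(* The unitaries "in nu". *)
Definition atoms (nu : probability (unitary R d) R) : set (unitary R d) :=
  [set U | (0 < nu [set U])%E].

Definition discrete_on (nu : probability (unitary R d) R) (S : nat) :=
  (atoms nu #= `I_S)%card /\ nu (atoms nu) = 1%E.

(* Probability of an event under a discrete nu.  An event defined by an
   arbitrary function on U(d) need not be Borel, and [nu] is meaningless on
   non-measurable sets; intersecting with the finite, nu-full set of atoms
   gives the total probability of the atoms in the event. *)
Definition dprob (nu : probability (unitary R d) R) (E : set (unitary R d)) : R :=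
  fine (nu (E `&` atoms nu)).

(* The neutral element 1 of the minimum is harmless: probabilities are at most
   1, and a discrete nu has an atom. *)
Definition pmin (nu : probability (unitary R d) R) : R :=
  \big[Order.min/1]_(U <- fset_set (atoms nu)) fine (nu [set U]).

Definition uniform_on_atoms (nu : probability (unitary R d) R) :=
  forall U V, atoms nu U -> atoms nu V -> nu [set U] = nu [set V].

End Designs.

(* Main.v *)
Require Import Defs.
From HB Require Import structures.
From mathcomp Require Import all_boot all_order all_algebra.
From mathcomp Require Import all_classical all_reals all_analysis.
From mathcomp Require Import complex.

Set Implicit Arguments.
Unset Strict Implicit.
Unset Printing Implicit Defensive.

Import Order.TTheory GRing.Theory Num.Theory.
Import numFieldNormedType.Exports.

Local Open Scope classical_set_scope.
Local Open Scope complex_scope.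
Local Open Scope ring_scope.

(** If [f] differs from [mu] at some atom [U], take [delta] to be the distance from [f (umx U)] to
    [mu]. The event then contains [U], so by monotonicity its probability is at least the mass of
    [U] ([dprob_ge]), which is at least the minimal mass ([pmin_le]). Monotonicity needs measurable
    events, hence Borel points ([measurable_unitary_set1]), which come from the Hausdorff topology
    on matrices. In the uniform case [S] equal masses add up to 1 ([measure_atoms]), so each is
    [1/S]. *)

Lemma matrix_coord_continuous (T : topologicalType) m n (i : 'I_m) (j : 'I_n) :
  continuous (fun M : 'M[T]_(m, n) => M i j).
Proof.
move=> M A MA; exists (fun i' j' => if (i' == i) && (j' == j) then A else setT).
  move=> i' j' /=; case: ifP => [/andP[/eqP-> /eqP->]//|_].
  exact: filterT.
by move=> N /(_ i j); rewrite /= !eqxx.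
Qed.

(** Neighbourhoods of an entry pull back to neighbourhoods of the matrix, so if [M] and [N] cannot
    be separated, neither can their entries. *)
Lemma matrix_hausdorff (T : topologicalType) m n :
  hausdorff_space T -> hausdorff_space 'M[T]_(m, n).
Proof.
move=> hT M N clMN; apply/matrixP => i j; apply: hT => A B MA NB.
by have [K [AK BK]] := clMN _ _ (matrix_coord_continuous MA)
  (matrix_coord_continuous NB); exists (K i j).
Qed.

(** A point is the preimage of a closed point under the continuous inclusion [umx], so its
    complement is open and generates the Borel structure with the other open sets. *)
Lemma measurable_unitary_set1 (R : realType) d (U : unitary R d) : measurable [set U].
Proof.
have -> : [set U] = @umx R d @^-1` [set umx U].
  by apply/seteqP; split=> [V ->//|V /=]; exact: val_inj.
rewrite -[X in measurable X]setCK; apply: measurableC; apply: sub_sigma_algebra.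
rewrite openC; apply: closed_comp => [V _|]; first exact: initial_continuous.
apply/accessible_closed_set1/hausdorff_accessible/matrix_hausdorff.
exact: (@norm_hausdorff _ R[i]^o).
Qed.

Lemma measurable_unitary_finite (R : realType) d (A : set (unitary R d)) :
  finite_set A -> measurable A.
Proof.
move=> finA; rewrite -(image_id A) -bigcup_imset1.
by apply: fin_bigcup_measurable => // U _; exact: measurable_unitary_set1.
Qed.

Section FiniteAtoms.
Variables (R : realType) (d : nat) (nu : probability (unitary R d) R).
Hypothesis finA : finite_set (atoms nu).

Lemma pmin_le U : atoms nu U -> pmin nu <= fine (nu [set U]).
Proof.
move=> aU; apply: (@bigmin_inf_seq _ _ _ _ _ U) => //.
by rewrite in_fset_set// mem_set.
Qed.

Lemma dprob_ge U E : atoms nu U -> E U -> fine (nu [set U]) <= dprob nu E.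
Proof.
move=> aU EU.
have mU := measurable_unitary_set1 U.
(* [E] is arbitrary, but its trace on the finite set of atoms is finite, hence Borel. *)
have mE : measurable (E `&` atoms nu).
  by apply: measurable_unitary_finite; apply: finite_setIr.
apply: fine_le; rewrite ?fin_num_measure//.
by apply: le_measure; rewrite ?inE// => V ->.
Qed.

Lemma measure_atoms : nu (atoms nu) = (\sum_(U \in atoms nu) nu [set U])%E.
Proof.
rewrite -measure_fin_bigcup//.
- by rewrite bigcup_imset1 image_id.
- by move=> U V _ _ [W [-> ->]].
- by move=> U _; exact: measurable_unitary_set1.
Qed.

End FiniteAtoms.

Lemma pmin_uniform (R : realType) d S (nu : probability (unitary R d) R) :
  discrete_on nu S -> uniform_on_atoms nu -> pmin nu = S%:R^-1.
Proof.
move=> [cardA nuA] unif.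
have finA : finite_set (atoms nu) by exists S.
have [U aU] : atoms nu !=set0.
  apply/set0P/eqP => A0; move: nuA.
  by rewrite A0 measure0 => /esym/eqP; rewrite onee_eq0.
have finU : nu [set U] \is a fin_num.
  by rewrite fin_num_measure//; exact: measurable_unitary_set1.
(* The total mass 1 is [S] times the common mass; this also forces [S] to be nonzero. *)
have nuUS : fine (nu [set U]) * S%:R = 1.
  apply: EFin_inj; rewrite -nuA measure_atoms// fsbig_finite//.
  rewrite (eq_big_seq (fun=> (fine (nu [set U]))%:E)); last first.
    move=> V; rewrite in_fset_set// => /set_mem aV.
    by rewrite (unif V U)// fineK.
  rewrite sumEFin big_const_seq count_predT iter_addr_0 (card_fset_set cardA).
  by rewrite mulr_natr.
have -> : S%:R^-1 = fine (nu [set U]).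
  have S0 : S%:R != 0 :> R.
    by apply: contra_eq_neq nuUS => ->; rewrite mulr0 eq_sym oner_eq0.
  by apply: (mulIf S0); rewrite nuUS mulVf.
apply/le_anti/andP; split; first exact: pmin_le.
rewrite /pmin big_seq; apply: le_bigmin.
  (* The common mass must also lie below the neutral element 1 of the minimum. *)
  by rewrite -lee_fin fineK//; apply: probability_le1; exact: measurable_unitary_set1.
by move=> V; rewrite in_fset_set// => /set_mem aV; rewrite (unif V U).
Qed.

Theorem theorem1p5 (R : realType) (d k S : nat) (eps : R)
    (H nu : probability (unitary R d) R)
    (f : 'M[R[i]]_d -> R[i]) (mu : R[i]) :
  (0 < d)%N -> is_haar H -> approx_design H nu eps k -> discrete_on nu S ->
  ((forall U, atoms nu U -> f (umx U) = mu) \/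
   exists2 delta : R, 0 < delta &
     pmin nu <= dprob nu [set U | delta%:C <= `|f (umx U) - mu|]) /\
  (uniform_on_atoms nu -> pmin nu = S%:R^-1).
Proof.
move=> _ _ _ nuS; split; last exact: pmin_uniform.
have finA : finite_set (atoms nu) by case: nuS => ? _; exists S.
have [fmu|] := pselect (forall U, atoms nu U -> f (umx U) = mu); first by left.
move=> /existsNP[U /not_implyP[aU /eqP fU]]; right.
(* The modulus has type [R[i]] with zero imaginary part; its real part serves as [delta]. *)
have Enorm : (complex.Re `|f (umx U) - mu|)%:C = `|f (umx U) - mu|.
  by rewrite normc_def.
exists (complex.Re `|f (umx U) - mu|).
  by rewrite -ltcR Enorm normr_gt0 subr_eq0.
by apply: (le_trans (pmin_le finA aU)); apply: dprob_ge; rewrite //= Enorm.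
Qed.
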